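(* Let \[\mathfrak{s}_{00}=\Big\{\mathbf{x}\in\ell_\infty:\sum_{\mathbf{x}(n)\neq0}\frac{1}{n}\text{ converges}\Big\}.\] Then: (1) $\mathfrak{s}_{00}$ is an ideal in $\ell_\infty$. (2) $\mathfrak{s}_{00}$ is non-unital. (3) $\mathfrak{s}_{00}$ is isometrically isomorphic to $C_{00}(Y)$ for the subspace \[Y=\bigcup\Big\{\mathrm{cl}_{\beta\mathbb{N}}A:A\subseteq\mathbb{N}\text{ and }\sum_{n\in A}\frac{1}{n}\text{ converges}\Big\}\] of $\beta\mathbb{N}$. (4) $\mathfrak{s}_{00}$ contains a copy of the normed algebra $\bigoplus_{n=1}^\infty\ell_\infty$. (5) $\mathfrak{s}_{00}/c_{00}$ contains a copy of the algebra $\bigoplus_{i<2^\omega}\frac{\ell_\infty}{c_{00}}$.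
   Context: $\mathbb{N}$ is the set of positive integers with the discrete topology and $\beta\mathbb{N}$ is its Stone–Čech compactification. $\ell_\infty$ is the normed algebra of bounded real sequences (pointwise operations, supremum norm), and $c_{00}$ is the set of real sequences with only finitely many non-zero terms. For a space $Y$, $C_{00}(Y)$ is the normed algebra (supremum norm) of bounded continuous $f:Y\to\mathbb{R}$ whose support (closure of $\{f\neq0\}$) is compact. ''Isometrically isomorphic'' means by an isometric algebra isomorphism. An algebra is unital if it has a multiplicative unit element. For a collection $\{X_i:i\in I\}$ of algebras, $\bigoplus_{i\in I}X_i$ is the algebra of all families $\{x_i\}_{i\in I}$ with $x_i\in X_i$ and $x_i=0$ for all but finitely many $i$, with component-wise operations; if the $X_i$ are normed it carries the norm $\sup_{i\in I}\|x_i\|_{X_i}$. The index set $i<2^\omega$ has the cardinality of the continuum. ''Contains a copy of the normed algebra $B$'' means contains a subalgebra isometrically isomorphic (as algebra) to $B$; ''contains a copy of the algebra $B$'' means contains a subalgebra isomorphic as an algebra to $B$. *)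

(* Defs.v *)
From HB Require Import structures.
From mathcomp Require Import all_boot all_order all_algebra.
From mathcomp Require Import generic_quotient ring_quotient.
From mathcomp Require Import all_classical all_reals all_analysis.
From mathcomp Require Import lra.

Set Implicit Arguments.
Unset Strict Implicit.
Unset Printing Implicit Defensive.
Import Order.TTheory GRing.Theory Num.Theory.
Import numFieldNormedType.Exports.
Local Open Scope classical_set_scope.
Local Open Scope ring_scope.
Local Open Scope quotient_scope.

(* The algebra structures of MathComp all carry a unit element, whereas most of
   the algebras considered here have none. *)
HB.mixin Record Lmodule_isNUAlgebra (R : comNzRingType) V
    of GRing.Lmodule R V := {
  amul : V -> V -> V;
  amulA : associative amul;
  amulDl : left_distributive amul +%R;
  amulDr : right_distributive amul +%R;
  amulZl : forall (a : R) (x y : V), amul (a *: x) y = a *: amul x y;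
  amulZr : forall (a : R) (x y : V), amul x (a *: y) = a *: amul x y
}.

#[short(type="nuAlgType")]
HB.structure Definition NUAlgebra (R : comNzRingType) :=
  {V of GRing.Lmodule R V & Lmodule_isNUAlgebra R V}.

HB.mixin Record NUAlgebra_isNormed (R : numFieldType) V
    of NUAlgebra R V & NormedModule R V := {
  normr_amul : forall x y : V, `|amul x y| <= `|x| * `|y|
}.

#[short(type="normedNuAlgType")]
HB.structure Definition NormedNUAlgebra (R : numFieldType) :=
  {V of NUAlgebra R V & NormedModule R V & NUAlgebra_isNormed R V}.

Section Notions.
Context {R : comNzRingType}.

Definition unital (A : nuAlgType R) : Prop :=
  exists u : A, forall x : A, amul u x = x /\ amul x u = x.

Record is_subalgebra (A : nuAlgType R) (S : set A) : Prop := {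
  subalgebra0 : S 0;
  subalgebraP : forall (a : R) x y, S x -> S y -> S (a *: x + y);
  subalgebraM : forall x y, S x -> S y -> S (amul x y)
}.

Record is_ideal (A : nuAlgType R) (J : set A) : Prop := {
  ideal0 : J 0;
  idealP : forall (a : R) x y, J x -> J y -> J (a *: x + y);
  idealMl : forall x y, J y -> J (amul x y);
  idealMr : forall x y, J x -> J (amul x y)
}.

Lemma ideal_subalgebra (A : nuAlgType R) (J : set A) :
  is_ideal J -> is_subalgebra J.
Proof. by case=> J0 JP Ml _; split=> // x y _; exact: Ml. Qed.

Record is_alg_hom (A B : nuAlgType R) (phi : A -> B) : Prop := {
  alg_homP : forall (a : R) x y, phi (a *: x + y) = a *: phi x + phi y;
  alg_homM : forall x y, phi (amul x y) = amul (phi x) (phi y)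
}.

Definition alg_isomorphic (A B : nuAlgType R) : Prop :=
  exists phi : A -> B, is_alg_hom phi /\ bijective phi.

End Notions.

Definition isometrically_isomorphic (R : numFieldType)
    (A B : normedNuAlgType R) : Prop :=
  exists phi : A -> B,
    [/\ is_alg_hom phi, bijective phi & forall x, `|phi x| = `|x|].

Section Subalgebra.
Context {R : comNzRingType} {A : nuAlgType R} {S : set A}.

Definition subalg_pred (hS : is_subalgebra S) : {pred A} := fun x => `[< S x >].

Lemma subalg_predP hS x : reflect (S x) (x \in subalg_pred hS).
Proof. exact: asboolP. Qed.

Lemma subalg_pred_submod hS : submod_closed (subalg_pred hS).
Proof.
split; first by apply/subalg_predP; exact: subalgebra0 hS.
move=> a x y /subalg_predP Sx /subalg_predP Sy; apply/subalg_predP.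
exact: subalgebraP.
Qed.

HB.instance Definition _ (hS : is_subalgebra S) :=
  GRing.isSubmodClosed.Build R A (subalg_pred hS) (subalg_pred_submod hS).

Record subalg (hS : is_subalgebra S) := Subalg {
  subalg_val :> A;
  _ : subalg_val \in subalg_pred hS
}.

HB.instance Definition _ hS := [isSub for @subalg_val hS].
HB.instance Definition _ hS := [Choice of subalg hS by <:].
HB.instance Definition _ hS := [SubChoice_isSubLmodule of subalg hS by <:].

Context (hS : is_subalgebra S).

Lemma subalg_valP (x : subalg hS) : S (val x).
Proof. by apply/(subalg_predP hS); exact: valP. Qed.

Definition subalg_mul (x y : subalg hS) : subalg hS :=
  Subalg (introT (subalg_predP hS _)
    (subalgebraM hS (subalg_valP x) (subalg_valP y))).

Lemma subalg_mulA : associative subalg_mul.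
Proof. by move=> x y z; apply: val_inj; exact: amulA. Qed.
Lemma subalg_mulDl : left_distributive subalg_mul +%R.
Proof. by move=> x y z; apply: val_inj; exact: amulDl. Qed.
Lemma subalg_mulDr : right_distributive subalg_mul +%R.
Proof. by move=> x y z; apply: val_inj; exact: amulDr. Qed.
Lemma subalg_mulZl (a : R) x y : subalg_mul (a *: x) y = a *: subalg_mul x y.
Proof. by apply: val_inj; exact: amulZl. Qed.
Lemma subalg_mulZr (a : R) x y : subalg_mul x (a *: y) = a *: subalg_mul x y.
Proof. by apply: val_inj; exact: amulZr. Qed.

HB.instance Definition _ := Lmodule_isNUAlgebra.Build R (subalg hS)
  subalg_mulA subalg_mulDl subalg_mulDr subalg_mulZl subalg_mulZr.

Lemma subalg_ideal (J : set A) :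
  is_ideal J -> is_ideal [set x : subalg hS | J (val x)].
Proof.
case=> J0 JP Ml Mr; split=> //=.
- by move=> a x y; exact: JP.
- by move=> x y; exact: Ml.
- by move=> x y; exact: Mr.
Qed.

End Subalgebra.

Section NormedSubalgebra.
Context {R : numFieldType} {A : normedNuAlgType R} {S : set A}.
Context (hS : is_subalgebra S).

Definition subalg_norm (x : subalg hS) : R := `|val x|.

Lemma subalg_normD x y :
  subalg_norm (x + y) <= subalg_norm x + subalg_norm y.
Proof. exact: ler_normD. Qed.
Lemma subalg_norm0_eq0 x : subalg_norm x = 0 -> x = 0.
Proof. by move/normr0_eq0 => x0; apply: val_inj. Qed.
Lemma subalg_normZ (a : R) x : subalg_norm (a *: x) = `|a| * subalg_norm x.
Proof. exact: normrZ. Qed.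

HB.instance Definition _ := Lmodule_isNormed.Build R (subalg hS)
  subalg_normD subalg_normZ subalg_norm0_eq0.

Lemma subalg_normM (x y : subalg hS) : `|amul x y| <= `|x| * `|y|.
Proof. exact: normr_amul. Qed.

HB.instance Definition _ := NUAlgebra_isNormed.Build R (subalg hS) subalg_normM.

End NormedSubalgebra.

Definition contains_copy (R : comNzRingType) (A B : nuAlgType R) : Prop :=
  exists (S : set A) (hS : is_subalgebra S), alg_isomorphic B (subalg hS).

Definition contains_normed_copy (R : numFieldType)
    (A B : normedNuAlgType R) : Prop :=
  exists (S : set A) (hS : is_subalgebra S),
    isometrically_isomorphic B (subalg hS).

Section Quotient.
Context {R : comNzRingType} {A : nuAlgType R} {J : set A}.
Context (hJ : is_ideal J).

Definition quotalg : Type := Quotient.quot (subalg_pred (ideal_subalgebra hJ)).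

HB.instance Definition _ := GRing.Zmodule.on quotalg.

Definition quotalg_pi (x : A) : quotalg :=
  \pi_(Quotient.quot (subalg_pred (ideal_subalgebra hJ))) x.

Local Notation pi := quotalg_pi.

Lemma quotalg_piP (x y : A) : pi x = pi y <-> J (x - y).
Proof.
have := Quotient.idealrBE (subalg_pred (ideal_subalgebra hJ)) x y => E.
split=> [/eqP xy|Jxy].
  by apply/(subalg_predP (ideal_subalgebra hJ)); rewrite E.
by apply/eqP; rewrite -[_ == _]E; apply/subalg_predP.
Qed.

Lemma quotalg_piW (X : quotalg) : exists x, X = pi x.
Proof. by exists (repr X); rewrite /quotalg_pi reprK. Qed.

Lemma quotalg_piD x y : pi (x + y) = pi x + pi y.
Proof. by rewrite /quotalg_pi !piE. Qed.

Definition quotalg_scale (a : R) (X : quotalg) : quotalg := pi (a *: repr X).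

Definition quotalg_mul (X Y : quotalg) : quotalg :=
  pi (amul (repr X) (repr Y)).

Lemma quotalg_repr x : J (repr (pi x) - x).
Proof. by apply/quotalg_piP; rewrite /quotalg_pi reprK. Qed.

Let JD x y : J x -> J y -> J (x + y).
Proof. by move=> Jx Jy; rewrite -[x]scale1r; exact: idealP. Qed.

Let JZ (a : R) x : J x -> J (a *: x).
Proof. by move=> Jx; rewrite -[_ *: _]addr0; apply: idealP => //; exact: ideal0. Qed.

Lemma quotalg_piZ a x : quotalg_scale a (pi x) = pi (a *: x).
Proof.
by apply/quotalg_piP; rewrite -scalerBr; apply: JZ; exact: quotalg_repr.
Qed.

Lemma quotalg_piM x y : quotalg_mul (pi x) (pi y) = pi (amul x y).
Proof.
apply/quotalg_piP; set u := repr _; set v := repr _.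
have -> : amul u v - amul x y = amul u (v - y) + amul (u - x) y.
  rewrite amulDr amulDl -[in amul u (- y)]scaleN1r -[in amul (- x) y]scaleN1r.
  by rewrite amulZl amulZr !scaleN1r addrA subrK.
by apply: JD; [apply: idealMl => //|apply: idealMr => //]; exact: quotalg_repr.
Qed.

Lemma quotalg_scaleA a b X :
  quotalg_scale a (quotalg_scale b X) = quotalg_scale (a * b) X.
Proof. by have [x ->] := quotalg_piW X; rewrite !quotalg_piZ scalerA. Qed.
Lemma quotalg_scale1 : left_id 1 quotalg_scale.
Proof. by move=> X; have [x ->] := quotalg_piW X; rewrite quotalg_piZ scale1r. Qed.
Lemma quotalg_scaleDr : right_distributive quotalg_scale +%R.
Proof.
move=> a X Y; have [x ->] := quotalg_piW X; have [y ->] := quotalg_piW Y.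
by rewrite -quotalg_piD !quotalg_piZ -quotalg_piD scalerDr.
Qed.
Lemma quotalg_scaleDl X : {morph quotalg_scale^~ X : a b / a + b}.
Proof.
by move=> a b; have [x ->] := quotalg_piW X; rewrite !quotalg_piZ -quotalg_piD scalerDl.
Qed.

HB.instance Definition _ := GRing.Zmodule_isLmodule.Build R quotalg
  quotalg_scaleA quotalg_scale1 quotalg_scaleDr quotalg_scaleDl.

Lemma quotalg_mulA : associative quotalg_mul.
Proof.
move=> X Y Z; have [x ->] := quotalg_piW X; have [y ->] := quotalg_piW Y.
by have [z ->] := quotalg_piW Z; rewrite !quotalg_piM amulA.
Qed.
Lemma quotalg_mulDl : left_distributive quotalg_mul +%R.
Proof.
move=> X Y Z; have [x ->] := quotalg_piW X; have [y ->] := quotalg_piW Y.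
by have [z ->] := quotalg_piW Z; rewrite -quotalg_piD !quotalg_piM -quotalg_piD amulDl.
Qed.
Lemma quotalg_mulDr : right_distributive quotalg_mul +%R.
Proof.
move=> X Y Z; have [x ->] := quotalg_piW X; have [y ->] := quotalg_piW Y.
by have [z ->] := quotalg_piW Z; rewrite -quotalg_piD !quotalg_piM -quotalg_piD amulDr.
Qed.
Lemma quotalg_mulZl (a : R) (X Y : quotalg) :
  quotalg_mul (a *: X) Y = a *: quotalg_mul X Y.
Proof.
have [x ->] := quotalg_piW X; have [y ->] := quotalg_piW Y.
by rewrite /GRing.scale /= !(quotalg_piZ, quotalg_piM) amulZl.
Qed.
Lemma quotalg_mulZr (a : R) (X Y : quotalg) :
  quotalg_mul X (a *: Y) = a *: quotalg_mul X Y.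
Proof.
have [x ->] := quotalg_piW X; have [y ->] := quotalg_piW Y.
by rewrite /GRing.scale /= !(quotalg_piZ, quotalg_piM) amulZr.
Qed.

HB.instance Definition _ := Lmodule_isNUAlgebra.Build R quotalg
  quotalg_mulA quotalg_mulDl quotalg_mulDr quotalg_mulZl quotalg_mulZr.

End Quotient.

Section DirectSum.
Context {R : comNzRingType} {I : Type} (X : I -> nuAlgType R).

Definition finsupp_pred : {pred forall i, X i} :=
  fun x => `[< finite_set [set i | x i != 0] >].

Record dirsum := Dirsum {
  dirsum_val :> forall i, X i;
  _ : dirsum_val \in finsupp_pred
}.

HB.instance Definition _ := [isSub for dirsum_val].
HB.instance Definition _ := [Choice of dirsum by <:].

Lemma dirsum_supp (x : dirsum) : finite_set [set i | x i != 0].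
Proof. by apply/asboolP; exact: (valP x). Qed.

Lemma dirsum_eqP (x y : dirsum) : x = y <-> forall i, x i = y i.
Proof.
by split=> [->//|xy]; apply: val_inj; apply: functional_extensionality_dep.
Qed.

Lemma finsupp1 (f : forall i, X i -> X i) (x : dirsum) :
  (forall i, f i 0 = 0) -> (fun i => f i (x i)) \in finsupp_pred.
Proof.
move=> f0; apply/asboolP; apply: sub_finite_set (dirsum_supp x) => i /=.
by apply: contra_neq => ->; rewrite f0.
Qed.

Lemma finsupp2 (f : forall i, X i -> X i -> X i) (x y : dirsum) :
  (forall i, f i 0 0 = 0) -> (fun i => f i (x i) (y i)) \in finsupp_pred.
Proof.
move=> f0; apply/asboolP; have := dirsum_supp x; have := dirsum_supp y.
move=> fy fx; have: finite_set ([set i | x i != 0] `|` [set i | y i != 0]).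
  by rewrite finite_setU.
apply: sub_finite_set => i /= f_neq0; apply/orP; apply: contra_neqT f_neq0.
by rewrite negb_or !negbK => /andP[/eqP -> /eqP ->]; rewrite f0.
Qed.

Lemma finsupp0 : (fun i => 0 : X i) \in finsupp_pred.
Proof.
apply/asboolP; suff -> : [set i | (0 : X i) != 0] = set0 by exact: finite_set0.
by apply/seteqP; split=> i //=; rewrite eqxx.
Qed.

Lemma amul00 i : amul (0 : X i) 0 = 0.
Proof. by have := amulZl (0 : R) (0 : X i) 0; rewrite !scale0r. Qed.

Definition dirsum0 := Dirsum finsupp0.
Definition dirsum_opp x :=
  Dirsum (@finsupp1 (fun i y => - y) x (fun i => @oppr0 (X i))).
Definition dirsum_add x y :=
  Dirsum (@finsupp2 (fun i y z => y + z) x y (fun i => addr0 (0 : X i))).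
Definition dirsum_scale (a : R) x :=
  Dirsum (@finsupp1 (fun i y => a *: y) x (fun i => @scaler0 R (X i) a)).
Definition dirsum_mul x y :=
  Dirsum (@finsupp2 (fun i y z => amul y z) x y amul00).

Lemma dirsum_addA : associative dirsum_add.
Proof. by move=> x y z; apply/dirsum_eqP => i; exact: addrA. Qed.
Lemma dirsum_addC : commutative dirsum_add.
Proof. by move=> x y; apply/dirsum_eqP => i; exact: addrC. Qed.
Lemma dirsum_add0 : left_id dirsum0 dirsum_add.
Proof. by move=> x; apply/dirsum_eqP => i; exact: add0r. Qed.
Lemma dirsum_addN : left_inverse dirsum0 dirsum_opp dirsum_add.
Proof. by move=> x; apply/dirsum_eqP => i; exact: addNr. Qed.

HB.instance Definition _ := GRing.isZmodule.Build dirsum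
  dirsum_addA dirsum_addC dirsum_add0 dirsum_addN.

Lemma dirsum_scaleA a b x :
  dirsum_scale a (dirsum_scale b x) = dirsum_scale (a * b) x.
Proof. by apply/dirsum_eqP => i; exact: scalerA. Qed.
Lemma dirsum_scale1 : left_id 1 dirsum_scale.
Proof. by move=> x; apply/dirsum_eqP => i; exact: scale1r. Qed.
Lemma dirsum_scaleDr : right_distributive dirsum_scale +%R.
Proof. by move=> a x y; apply/dirsum_eqP => i; exact: scalerDr. Qed.
Lemma dirsum_scaleDl x : {morph dirsum_scale^~ x : a b / a + b}.
Proof. by move=> a b; apply/dirsum_eqP => i; exact: scalerDl. Qed.

HB.instance Definition _ := GRing.Zmodule_isLmodule.Build R dirsum
  dirsum_scaleA dirsum_scale1 dirsum_scaleDr dirsum_scaleDl.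

Lemma dirsum_mulA : associative dirsum_mul.
Proof. by move=> x y z; apply/dirsum_eqP => i; exact: amulA. Qed.
Lemma dirsum_mulDl : left_distributive dirsum_mul +%R.
Proof. by move=> x y z; apply/dirsum_eqP => i; exact: amulDl. Qed.
Lemma dirsum_mulDr : right_distributive dirsum_mul +%R.
Proof. by move=> x y z; apply/dirsum_eqP => i; exact: amulDr. Qed.
Lemma dirsum_mulZl (a : R) (x y : dirsum) :
  dirsum_mul (a *: x) y = a *: dirsum_mul x y.
Proof. by apply/dirsum_eqP => i; exact: amulZl. Qed.
Lemma dirsum_mulZr (a : R) (x y : dirsum) :
  dirsum_mul x (a *: y) = a *: dirsum_mul x y.
Proof. by apply/dirsum_eqP => i; exact: amulZr. Qed.

HB.instance Definition _ := Lmodule_isNUAlgebra.Build R dirsum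
  dirsum_mulA dirsum_mulDl dirsum_mulDr dirsum_mulZl dirsum_mulZr.

End DirectSum.

(* [sup set0 = 0], so the empty index set needs no special treatment. *)
Section SupNorm.
Context {R : realType} {I : Type}.

Definition bounded_above (F : I -> R) := exists M, forall i, F i <= M.

Lemma sup_range_ge (F : I -> R) i : bounded_above F -> F i <= sup (range F).
Proof.
move=> [M FM]; apply: ub_le_sup; last by exists i.
by exists M => _ [j _ <-].
Qed.

Lemma sup_range_le (F : I -> R) M :
  0 <= M -> (forall i, F i <= M) -> sup (range F) <= M.
Proof.
move=> M0 FM; have [i|I0] := pselect (exists i : I, True).
  by apply: ge_sup => [|_ [j _ <-]//]; case: i => i _; exists (F i); exists i.
suff -> : range F = set0 by rewrite sup0.
by apply/seteqP; split=> // y [i _ _]; apply: I0; exists i.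
Qed.

Lemma sup_range_ge0 (F : I -> R) :
  bounded_above F -> (forall i, 0 <= F i) -> 0 <= sup (range F).
Proof.
move=> bF F0; have [[i _]|I0] := pselect (exists i : I, True).
  exact: le_trans (F0 i) (sup_range_ge i bF).
suff -> : range F = set0 by rewrite sup0.
by apply/seteqP; split=> // y [i _ _]; apply: I0; exists i.
Qed.

Lemma sup_rangeZ (F : I -> R) (a : R) : 0 <= a -> bounded_above F ->
  (forall i, 0 <= F i) -> sup (range (fun i => a * F i)) = a * sup (range F).
Proof.
move=> a0 bF F0; apply/eqP; rewrite eq_le; apply/andP; split.
  apply: sup_range_le; first by rewrite mulr_ge0// sup_range_ge0.
  by move=> i; rewrite ler_wpM2l// sup_range_ge.
have baF : bounded_above (fun i => a * F i).
  by case: bF => M FM; exists (a * M) => i; rewrite ler_wpM2l.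
have [a_eq0|a_neq0] := eqVneq a 0.
  rewrite a_eq0 mul0r; apply: sup_range_ge0 => [|i]; last by rewrite mul0r.
  by exists 0 => i; rewrite mul0r.
have a_gt0 : 0 < a by rewrite lt_neqAle eq_sym a_neq0.
rewrite mulrC -ler_pdivlMr//; apply: sup_range_le.
  by rewrite divr_ge0//; apply: sup_range_ge0 => // i; rewrite mulr_ge0.
by move=> i; rewrite ler_pdivlMr// mulrC; exact: (sup_range_ge i baF).
Qed.

End SupNorm.

Section NormedDirectSum.
Context {R : realType} {I : Type} (X : I -> normedNuAlgType R).

Definition dirsum_norm (x : dirsum X) : R := sup (range (fun i => `|x i|)).

Lemma dirsum_bounded (x : dirsum X) : bounded_above (fun i => `|x i|).
Proof.
have : finite_set ((fun i => `|x i|) @` [set i | x i != 0]).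
  exact/finite_image/dirsum_supp.
move=> /finite_seqP[F FE]; exists (\sum_(r <- F) `|r|) => i.
have [->|xi0] := eqVneq (x i) 0; first by rewrite normr0 sumr_ge0.
have xiF : `|x i| \in F.
  have : [set` F] `|x i| by rewrite -FE; exists i.
  by [].
by rewrite (big_rem _ xiF) /= normr_id lerDl sumr_ge0.
Qed.

Lemma dirsum_normD x y : dirsum_norm (x + y) <= dirsum_norm x + dirsum_norm y.
Proof.
apply: sup_range_le => [|i].
  by rewrite addr_ge0// sup_range_ge0//; exact: dirsum_bounded.
apply: le_trans (ler_normD _ _) _; apply: lerD.
  exact: (sup_range_ge i (dirsum_bounded x)).
exact: (sup_range_ge i (dirsum_bounded y)).
Qed.

Lemma dirsum_normZ (a : R) x : dirsum_norm (a *: x) = `|a| * dirsum_norm x.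
Proof.
rewrite -sup_rangeZ//; last exact: dirsum_bounded.
by congr (sup _); apply: eq_imagel => i _; exact: normrZ.
Qed.

Lemma dirsum_norm0_eq0 x : dirsum_norm x = 0 -> x = 0.
Proof.
move=> x0; apply/dirsum_eqP => i; apply/normr0_eq0/eqP.
by rewrite eq_le normr_ge0 andbT -x0 (sup_range_ge i (dirsum_bounded x)).
Qed.

HB.instance Definition _ := Lmodule_isNormed.Build R (dirsum X)
  dirsum_normD dirsum_normZ dirsum_norm0_eq0.

Lemma dirsum_normM (x y : dirsum X) : `|amul x y| <= `|x| * `|y|.
Proof.
apply: sup_range_le => [|i]; first by rewrite mulr_ge0.
apply: le_trans (normr_amul _ _) _; apply: ler_pM => //.
  exact: (sup_range_ge i (dirsum_bounded x)).
exact: (sup_range_ge i (dirsum_bounded y)).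
Qed.

HB.instance Definition _ := NUAlgebra_isNormed.Build R (dirsum X) dirsum_normM.

End NormedDirectSum.

(* The normed algebra of all bounded real functions on a set. *)
Section BoundedFunctions.
Context {R : realType} {T : Type}.

Definition bfun_pred : {pred T -> R} := fun f => `[< bounded_fun f >].

Lemma bfun_predP (f : T -> R) :
  reflect (bounded_above (fun t => `|f t|)) (f \in bfun_pred).
Proof.
apply: (iffP (asboolP _)) => [[M [_ fM]]|[M fM]].
  by exists (M + 1) => t; apply: fM => //; rewrite ltrDl.
exists M; split; first exact: num_real.
by move=> N MN t _; exact: le_trans (fM t) (ltW MN).
Qed.

Lemma bfun_submod : submod_closed bfun_pred.
Proof.
split; first by apply/bfun_predP; exists 0 => t; rewrite normr0.
move=> a f g /bfun_predP[M fM] /bfun_predP[N gN]; apply/bfun_predP.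
exists (`|a| * M + N) => t; apply: le_trans (ler_normD _ _) _.
by rewrite lerD// normrM ler_wpM2l.
Qed.

HB.instance Definition _ :=
  GRing.isSubmodClosed.Build R (T -> R) bfun_pred bfun_submod.

Record bfun := Bfun { bfun_val :> T -> R; _ : bfun_val \in bfun_pred }.

HB.instance Definition _ := [isSub for bfun_val].
HB.instance Definition _ := [Choice of bfun by <:].
HB.instance Definition _ := [SubChoice_isSubLmodule of bfun by <:].

Lemma bfun_bounded (f : bfun) : bounded_above (fun t => `|f t|).
Proof. by apply/bfun_predP; exact: (valP f). Qed.

Lemma bfun_eqP (f g : bfun) : f = g <-> forall t, f t = g t.
Proof. by split=> [->//|fg]; apply: val_inj; apply/funext. Qed.

Lemma bfunD (f g : bfun) t : (f + g) t = f t + g t.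
Proof. by []. Qed.
Lemma bfunZ (a : R) (f : bfun) t : (a *: f) t = a * f t.
Proof. by []. Qed.

Lemma bfun_mul_subproof (f g : bfun) : (fun t => f t * g t) \in bfun_pred.
Proof.
have [M fM] := bfun_bounded f; have [N gN] := bfun_bounded g.
by apply/bfun_predP; exists (M * N) => t; rewrite normrM ler_pM.
Qed.

Definition bfun_mul f g := Bfun (bfun_mul_subproof f g).

Lemma bfun_mulA : associative bfun_mul.
Proof. by move=> f g h; apply/bfun_eqP => t; exact: mulrA. Qed.
Lemma bfun_mulDl : left_distributive bfun_mul +%R.
Proof. by move=> f g h; apply/bfun_eqP => t; exact: mulrDl. Qed.
Lemma bfun_mulDr : right_distributive bfun_mul +%R.
Proof. by move=> f g h; apply/bfun_eqP => t; exact: mulrDr. Qed.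
Lemma bfun_mulZl (a : R) (f g : bfun) : bfun_mul (a *: f) g = a *: bfun_mul f g.
Proof. by apply/bfun_eqP => t; rewrite /= -mulrA. Qed.
Lemma bfun_mulZr (a : R) (f g : bfun) : bfun_mul f (a *: g) = a *: bfun_mul f g.
Proof. by apply/bfun_eqP => t; rewrite /= mulrCA. Qed.

HB.instance Definition _ := Lmodule_isNUAlgebra.Build R bfun
  bfun_mulA bfun_mulDl bfun_mulDr bfun_mulZl bfun_mulZr.

Definition bfun_norm (f : bfun) : R := sup (range (fun t => `|f t|)).

Lemma bfun_normD f g : bfun_norm (f + g) <= bfun_norm f + bfun_norm g.
Proof.
apply: sup_range_le => [|t].
  by rewrite addr_ge0// sup_range_ge0//; exact: bfun_bounded.
apply: le_trans (ler_normD _ _) _; apply: lerD.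
  exact: (sup_range_ge t (bfun_bounded f)).
exact: (sup_range_ge t (bfun_bounded g)).
Qed.

Lemma bfun_normZ (a : R) f : bfun_norm (a *: f) = `|a| * bfun_norm f.
Proof.
rewrite -sup_rangeZ//; last exact: bfun_bounded.
by congr (sup _); apply: eq_imagel => t _; exact: (normrM a (f t)).
Qed.

Lemma bfun_norm0_eq0 f : bfun_norm f = 0 -> f = 0.
Proof.
move=> f0; apply/bfun_eqP => t; apply/normr0_eq0/eqP.
by rewrite eq_le normr_ge0 andbT -f0 (sup_range_ge t (bfun_bounded f)).
Qed.

HB.instance Definition _ := Lmodule_isNormed.Build R bfun
  bfun_normD bfun_normZ bfun_norm0_eq0.

Lemma bfun_normM (f g : bfun) : `|amul f g| <= `|f| * `|g|.
Proof.
apply: sup_range_le => [|t]; first by rewrite mulr_ge0.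
rewrite normrM; apply: ler_pM => //.
  exact: (sup_range_ge t (bfun_bounded f)).
exact: (sup_range_ge t (bfun_bounded g)).
Qed.

HB.instance Definition _ := NUAlgebra_isNormed.Build R bfun bfun_normM.

End BoundedFunctions.

Arguments bfun R T : clear implicits.

Section CompactSupport.
Context (R : realType) (Y : topologicalType).

Definition csupp_set : set (bfun R Y) :=
  [set f | continuous f /\ compact (closure [set y | f y != 0])].

Lemma csupp_subalgebra : is_subalgebra csupp_set.
Proof.
have cl2 (f g h : Y -> R) : compact (closure [set y | f y != 0]) ->
    compact (closure [set y | g y != 0]) ->
    (forall y, f y = 0 -> g y = 0 -> h y = 0) ->
    compact (closure [set y | h y != 0]).
  move=> cf cg fgh; apply: subclosed_compact (compactU cf cg) _.
    exact: closed_closure.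
  rewrite -closureU; apply: closure_subset => y /=; apply: contra_neqP.
  by move=> /not_orP[/negP + /negP]; rewrite !negbK => /eqP + /eqP; exact: fgh.
split.
- split; first exact: cst_continuous.
  suff -> : [set y | (0 : bfun R Y) y != 0] = set0.
    by rewrite closure0; exact: compact0.
  by apply/seteqP; split=> y //=; rewrite eqxx.
- move=> a f g [cf sf] [cg sg]; split.
    have -> : bfun_val (a *: f + g) = (fun y => a * f y + g y).
      by apply/funext => y; rewrite bfunD bfunZ.
    move=> y; have fy := cf y; have gy := cg y.
    exact: (cvgD (cvgM (cvg_cst a) fy) gy).
  by apply: (cl2 f g) => // y fy gy; rewrite bfunD bfunZ fy gy mulr0 addr0.
- move=> f g [cf sf] [cg sg]; split.
    move=> y; have fy := cf y; have gy := cg y.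
    exact: (@cvgM R Y (nbhs y) _ (f : Y -> R) (g : Y -> R) (f y) (g y) fy gy).
  by apply: (cl2 f g) => // y fy gy; rewrite /= fy mul0r.
Qed.

End CompactSupport.

Notation C00 R Y := (subalg (csupp_subalgebra R Y)).

(* Sequences are indexed by [nat]; the index [n] stands for the positive
   integer [n.+1], whose reciprocal is [harmonic n]. *)
Notation linfty R := (bfun R nat).

Section Sequences.
Context (R : realType).

Definition summable_set (A : set nat) : Prop :=
  cvgn [series \1_A n * harmonic n : R]_n.

Definition s00 : set (linfty R) := [set x | summable_set [set n | x n != 0]].

Definition c00 : set (linfty R) := [set x | finite_set [set n | x n != 0]].

Lemma c00_ideal : is_ideal c00.
Proof.
split.
- rewrite /c00 /=; suff -> : [set n | (0 : linfty R) n != 0] = set0.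
    exact: finite_set0.
  by apply/seteqP; split=> n //=; rewrite eqxx.
- move=> a x y fx fy.
  have : finite_set ([set n | x n != 0] `|` [set n | y n != 0]).
    by rewrite finite_setU.
  apply: sub_finite_set => n /=; apply: contra_neqP.
  move=> /not_orP[/negP + /negP]; rewrite !negbK => /eqP xn /eqP yn.
  by change (a * x n + y n = 0); rewrite xn yn mulr0 addr0.
- move=> x y; apply: sub_finite_set => n /=.
  by apply: contra_neq => yn; rewrite /= yn mulr0.
- move=> x y; apply: sub_finite_set => n /=.
  by apply: contra_neq => xn; rewrite /= xn mul0r.
Qed.

End Sequences.

Arguments s00 R : clear implicits.
Arguments c00 R : clear implicits.

Notation linfty_mod_c00 R := (quotalg (c00_ideal R)).

Notation s00_alg hs := (subalg (ideal_subalgebra hs)).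

(* [c00] is contained in [s00], so this quotients by all of [c00]. *)
Notation s00_mod_c00 hs :=
  (quotalg (subalg_ideal (ideal_subalgebra hs) (c00_ideal _))).

(* [e] is a compactification of [X] in which [X] is C*-embedded; this determines it up
   to a homeomorphism that fixes [X]. *)
Record is_stone_cech (R : realType) (X bX : topologicalType) (e : X -> bX) :
    Prop := {
  stone_cech_compact : compact [set: bX];
  stone_cech_hausdorff : hausdorff_space bX;
  stone_cech_inj : injective e;
  stone_cech_continuous : continuous e;
  stone_cech_embedding :
    forall U : set X, open U -> exists2 V : set bX, open V & U = e @^-1` V;
  stone_cech_dense : dense (range e);
  stone_cech_extend : forall f : X -> R, continuous f -> bounded_fun f ->
    exists2 g : bX -> R, continuous g & forall x, g (e x) = f x
}.

Lemma compact_set_type (X : topologicalType) (C : set X) :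
  compact C -> compact [set: set_type C].
Proof.
move=> cC F PF _.
have /cC : (set_val @ F) C.
  by apply: (@filterS _ F _ setT _ _ filterT) => x _; exact: set_valP.
move=> [p [Cp clp]].
exists (exist _ p (mem_set Cp)); split=> // A B FA [_ [[V oV <-] Vp] VB].
have FA' : (set_val @ F) (set_val @` A).
  by rewrite /fmap /=; apply: (@filterS _ F _ A _ _ FA) => x Ax; exists x.
have [_ [[x Ax <-] Vx]] := clp _ V FA' (open_nbhs_nbhs (conj oV Vp)).
by exists x; split=> //; exact: VB.
Qed.

Lemma stone_cech_exists (R : realType) :
  exists (bN : topologicalType) (e : nat -> bN), is_stone_cech R e.
Proof.
pose P : topologicalType := prod_topology (fun _ : bfun R nat => R : topologicalType).
pose ev (n : nat) : P := fun j => j n.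
have /choice[B jB] (j : bfun R nat) : exists M, forall n, `|j n| <= M.
  exact: bfun_bounded.
have haus : hausdorff_space P by apply: hausdorff_product => j; exact: Rhausdorff.
have cK : compact [set f : P | forall j, `[- B j, B j]%classic (f j)].
  apply: (@tychonoff (bfun R nat) (fun=> R : topologicalType)
    (fun j => `[- B j, B j]%classic)) => j.
  exact: segment_compact.
pose C := closure (range ev).
have cC : compact C.
  have clK := compact_closed haus cK.
  apply: subclosed_compact cK _; first exact: closed_closure.
  rewrite [X in _ `<=` X]((closure_id _).1 clK).
  apply: closure_subset => _ [n _ <-] j /=.
  by rewrite in_itv /= -ler_norml; exact: jB.
have Cev n : C (ev n) by apply: subset_closure; exists n.
pose e n : set_type C := exist _ (ev n) (mem_set (Cev n)).
have pc (j : bfun R nat) : continuous (fun p : set_type C => (set_val p : P) j).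
  move=> p; apply: (@continuous_comp _ P _ set_val (fun f : P => f j)).
    exact: initial_continuous.
  exact: (@proj_continuous _ _ j).
have bI (U : set nat) : (\1_U : nat -> R) \in bfun_pred.
  apply/bfun_predP; exists 1 => n; rewrite indicE.
  by case: (n \in U); rewrite ?normr1 ?normr0.
exists (set_type C), e; split.
- exact: compact_set_type.
- move=> p q clpq; apply: val_inj; apply: haus => U V /= pU qV.
  have [x [Ux Vx]] := clpq _ _ (initial_continuous pU) (initial_continuous qV).
  by exists (set_val x).
- move=> m n /(congr1 (fun p => (set_val p : P) (Bfun (bI [set m])))).
  change (\1_[set m] m = \1_[set m] n :> R -> m = n).
  rewrite !indicE mem_set// => /eqP.
  case: (boolP (n \in [set m])) => [|_]; last by rewrite oner_eq0.
  by rewrite inE.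
- move=> n U /nbhs_singleton Un; have : nbhs n (e @^-1` U); last by [].
  by rewrite nbhs_principalE; apply/principal_filterP.
- move=> U _; pose g (p : set_type C) := (set_val p : P) (Bfun (bI U)).
  exists (g @^-1` [set r | 1/2 < r]).
    by move/continuousP: (pc (Bfun (bI U))); apply; exact: open_gt.
  have : U = [set n | 1/2 < \1_U n :> R]; last exact.
  apply/seteqP; split=> n /=; rewrite indicE.
    by move=> Un; rewrite mem_set//=; lra.
  by case: (boolP (n \in U)) => [|_] /=; [rewrite inE|lra].
- move=> O [p Op] [V oV VO]; move: Op; rewrite -VO => Vp.
  have [_ [[n _ <-] Vn]] := set_valP p V (open_nbhs_nbhs (conj oV Vp)).
  by exists (e n); split; [exact: Vn|exists n].
- move=> f _ bf.
  have fb : f \in bfun_pred by apply/asboolP.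
  by exists (fun p : set_type C => (set_val p : P) (Bfun fb)) => //; exact: pc.
Qed.

Definition Yset (R : realType) (bN : topologicalType) (e : nat -> bN) : set bN :=
  \bigcup_(A in summable_set R) closure (e @` A).

(* Main.v *)
Require Import Defs.
From mathcomp Require Import finmap.
From mathcomp Require Import all_boot all_order all_algebra.
From mathcomp Require Import all_classical all_reals all_analysis.
From mathcomp Require Import lra.
Set Implicit Arguments.
Unset Strict Implicit.
Unset Printing Implicit Defensive.
Import Order.TTheory GRing.Theory Num.Theory.
Import numFieldNormedType.Exports.
Local Open Scope ring_scope.
Local Open Scope classical_set_scope.

(** Three facts about summable sets of integers are needed: they are closed
under subsets and finite unions, the set of all integers is not summable, and
the set of powers of 2 is an infinite summable set.

The first fact makes [s00] an ideal ([s00_ideal]); the second forbids a unit,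
since a unit would be the constant sequence 1 ([s00_nonunital]).

Restricting a function on [Y] to the integers gives the isometry with the
algebra of compactly supported functions ([restrict]). It preserves norms
because the integers are dense in [Y]. The closures of summable sets are
clopen in the compactification and form a directed cover of [Y], so a compact
support lies in a single one of them and the restriction has summable support
([restrict_s00]). Conversely the extension of a sequence with summable support
[A] lives on the closure of [A], which is a compact subset of [Y]
([restrict_surj]).

For the two copies, sequences are pushed forward along an injection into the
powers of 2 ([push]); this is an isometric embedding of bounded functions on
any countable set into [s00]. A finitely supported sequence of bounded
sequences is in particular a bounded double sequence, which gives the copy of
the countable direct sum ([s00_contains_linfty_sum]). Modulo [c00], the
branches of the binary tree, coded by powers of 2, form an almost disjoint
family of size continuum. Pushing forward along different branches gives
embeddings of [linfty] modulo [c00] whose ranges annihilate each other, and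
orthogonal embeddings of unital algebras add up to an embedding of their
direct sum ([dirsum_map_inj], [s00_mod_c00_contains_quotient_sum]). *)

(** * Homomorphisms, quotients and direct sums of algebras *)

Section AlgebraHomomorphisms.
Context {R : comNzRingType}.
Implicit Types A B C : nuAlgType R.

Lemma alg_homD A B (f : A -> B) : is_alg_hom f -> {morph f : x y / x + y}.
Proof. by case=> fP _ x y; rewrite -[x in LHS]scale1r fP scale1r. Qed.

Lemma alg_hom0 A B (f : A -> B) : is_alg_hom f -> f 0 = 0.
Proof. by move=> hf; apply: (@addrI _ (f 0)); rewrite -alg_homD// !addr0. Qed.

Lemma alg_homZ A B (f : A -> B) a x : is_alg_hom f -> f (a *: x) = a *: f x.
Proof. by move=> hf; rewrite -[a *: x]addr0 (alg_homP hf) (alg_hom0 hf) addr0. Qed.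

Lemma alg_homB A B (f : A -> B) : is_alg_hom f -> {morph f : x y / x - y}.
Proof. by move=> hf x y; rewrite alg_homD// -scaleN1r alg_homZ// scaleN1r. Qed.

Lemma alg_hom_inj A B (f : A -> B) :
  is_alg_hom f -> (forall x, f x = 0 -> x = 0) -> injective f.
Proof.
move=> hf f0 x y fxy; apply/eqP; rewrite -subr_eq0; apply/eqP/f0.
by rewrite alg_homB// fxy subrr.
Qed.

Lemma alg_hom_comp A B C (f : A -> B) (g : B -> C) :
  is_alg_hom f -> is_alg_hom g -> is_alg_hom (g \o f).
Proof.
move=> [fP fM] [gP gM].
by split=> [a x y|x y]; rewrite /= (fP, fM) (gP, gM).
Qed.

Lemma alg_hom_can A B (f : A -> B) (g : B -> A) :
  is_alg_hom f -> injective f -> cancel g f -> is_alg_hom g.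
Proof.
move=> [fP fM] finj gK; split=> [a x y|x y]; apply: finj.
  by rewrite fP !gK.
by rewrite fM !gK.
Qed.

Lemma alg_hom_range A B (f : B -> A) :
  is_alg_hom f -> is_subalgebra (range f).
Proof.
move=> hf; split=> [|a _ _ [x _ <-] [y _ <-]|_ _ [x _ <-] [y _ <-]].
- by exists 0 => //; exact: alg_hom0.
- by exists (a *: x + y) => //; exact: alg_homP.
- by exists (amul x y) => //; exact: alg_homM.
Qed.

(** The passage from an injective homomorphism to a copy: an embedding
corestricts to an isomorphism onto its range, and [val (g x) = f x] is what
lets the norm be followed through the corestriction. *)
Lemma alg_hom_corange A B (f : B -> A) (hf : is_alg_hom f) : injective f ->
  exists g : B -> subalg (alg_hom_range hf),
    [/\ is_alg_hom g, bijective g & forall x, val (g x) = f x].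
Proof.
move=> finj; set hS := alg_hom_range hf.
pose g x : subalg hS := Subalg (introT (subalg_predP hS (f x)) (imageT f x)).
exists g; split=> //.
  by split=> [a x y|x y]; apply: val_inj; rewrite /= (alg_homP hf, alg_homM hf).
have /choice[h hK] (y : subalg hS) : exists x, f x = val y.
  by have [x _ fx] := subalg_valP y; exists x.
by exists h => x; [apply: finj; rewrite hK|apply: val_inj; exact: hK].
Qed.

Lemma inj_hom_contains_copy A B (f : B -> A) :
  is_alg_hom f -> injective f -> contains_copy A B.
Proof.
move=> hf finj; exists (range f), (alg_hom_range hf).
by have [g [hg gbij _]] := alg_hom_corange hf finj; exists g.
Qed.

Lemma quotalg_pi_eq0 A (J : set A) (hJ : is_ideal J) x :
  quotalg_pi hJ x = 0 <-> J x.
Proof.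
have -> : 0 = quotalg_pi hJ 0.
  by apply: (@addrI _ (quotalg_pi hJ 0)); rewrite -quotalg_piD !addr0.
by rewrite quotalg_piP subr0.
Qed.

Section QuotientHomomorphism.
Context {A B : nuAlgType R} {J : set A} {K : set B}.
Context (hJ : is_ideal J) (hK : is_ideal K) (f : A -> B).

Definition quotalg_map (X : quotalg hJ) : quotalg hK :=
  quotalg_pi hK (f (repr X)).

Hypothesis hf : is_alg_hom f.
Hypothesis fJ : forall x, J x -> K (f x).

(** The defining formula picks a representative; [f] mapping [J] into [K] makes
the choice irrelevant. *)
Lemma quotalg_mapE x : quotalg_map (quotalg_pi hJ x) = quotalg_pi hK (f x).
Proof.
by apply/quotalg_piP; rewrite -alg_homB//; apply/fJ/quotalg_repr.
Qed.

Lemma quotalg_map_hom : is_alg_hom quotalg_map.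
Proof.
split=> [a X Y|X Y]; have [x ->] := quotalg_piW X; have [y ->] := quotalg_piW Y.
  rewrite /GRing.scale/= quotalg_piZ -quotalg_piD !quotalg_mapE.
  by rewrite quotalg_piZ -quotalg_piD alg_homP.
rewrite /amul/= quotalg_piM !quotalg_mapE.
by rewrite quotalg_piM alg_homM.
Qed.

Lemma quotalg_map_inj : (forall x, K (f x) -> J x) -> injective quotalg_map.
Proof.
move=> fK X Y; have [x ->] := quotalg_piW X; have [y ->] := quotalg_piW Y.
rewrite !quotalg_mapE => /quotalg_piP; rewrite -alg_homB// => /fK.
by move/quotalg_piP.
Qed.

End QuotientHomomorphism.

Lemma amul_sumr (A : nuAlgType R) (J : Type) (s : seq J) (u : J -> A) v :
  amul v (\sum_(i <- s) u i) = \sum_(i <- s) amul v (u i).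
Proof.
apply: (big_morph (amul v)); first exact: amulDr.
by rewrite -[0 in LHS](scale0r 0) amulZr scale0r.
Qed.

Lemma amul_suml (A : nuAlgType R) (J : Type) (s : seq J) (u : J -> A) v :
  amul (\sum_(i <- s) u i) v = \sum_(i <- s) amul (u i) v.
Proof.
apply: (big_morph (amul^~ v)); first by move=> x y; exact: amulDl.
by rewrite -[0 in LHS](scale0r 0) amulZl scale0r.
Qed.

Section OrthogonalSum.
Context {I : choiceType} {B : I -> nuAlgType R} {C : nuAlgType R}.
Context (h : forall i, B i -> C).

(** The sum ranges over all of [I]: at each element of the direct sum only
finitely many summands are nonzero. *)
Definition dirsum_map (x : dirsum B) : C := \sum_(i \in [set: I]) h (x i).

Hypothesis hh : forall i, is_alg_hom (@h i).

(** Any finite set covering the support will do as summation range, so that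
several elements can be summed over one common range. *)
Lemma dirsum_mapE (x : dirsum B) (F : {fset I}) :
  (forall i, x i != 0 -> i \in F) -> dirsum_map x = \sum_(i <- F) h (x i).
Proof.
move=> xF; apply: fsbigTE => i iF.
have [->|/xF] := eqVneq (x i) 0; first exact: alg_hom0.
by rewrite (negbTE iF).
Qed.

Hypothesis h_orth : forall i j (x : B i) (y : B j),
  i != j -> amul (h x) (h y) = 0.

(** In the product of two sums the mixed terms vanish by orthogonality, and
what remains is the sum of the componentwise products. *)
Lemma dirsum_map_hom : is_alg_hom dirsum_map.
Proof.
have cover (x y : dirsum B) : exists F : {fset I},
    forall i, ((x i != 0) || (y i != 0)) -> i \in F.
  exists (fset_set ([set i | x i != 0] `|` [set i | y i != 0])) => i xy0.
  rewrite in_fset_set; first by rewrite inE; exact/orP.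
  by rewrite finite_setU; split; exact: dirsum_supp.
split=> [a x y|x y]; have [F xyF] := cover x y.
all: rewrite !(@dirsum_mapE _ F).
all: try by move=> i xi0; apply: xyF; rewrite xi0 ?orbT.
- rewrite scaler_sumr -big_split/=; apply: eq_bigr => i _.
  exact: alg_homP.
- move=> i; apply: contraR => /(contra (@xyF i)).
  rewrite negb_or !negbK => /andP[/eqP xi0 /eqP yi0].
  by apply/eqP; rewrite -[LHS]/(a *: x i + y i) xi0 yi0 scaler0 addr0.
- rewrite amul_suml; apply: eq_big_seq => i iF.
  rewrite amul_sumr (big_fsetD1 i)//= [X in _ + X]big_seq [X in _ + X]big1 ?addr0.
    exact: alg_homM.
  by move=> j; rewrite in_fsetD1 eq_sym => /andP[ij _]; exact: h_orth.
- move=> i; apply: contraR => /(contra (@xyF i)).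
  rewrite negb_or !negbK => /andP[/eqP xi0 /eqP yi0].
  by apply/eqP; rewrite -[LHS]/(amul (x i) (y i)) xi0 yi0 amul00.
Qed.

(** Multiplying the sum by the image of the unit of the summand [B i] kills all
the other summands, so the [i]-th component can be read off the sum. *)
Lemma dirsum_map_inj : (forall i, unital (B i)) ->
  (forall i, injective (@h i)) -> injective dirsum_map.
Proof.
move=> B1 hinj; apply: alg_hom_inj dirsum_map_hom _ => x hx0.
apply/dirsum_eqP => i; apply: (hinj i); rewrite (alg_hom0 (hh i)).
have [e e1] := B1 i; rewrite -(e1 (x i)).1 (alg_homM (hh i)).
pose F := fset_set [set i | x i != 0].
have inF j : (j \in F) = (x j != 0).
  rewrite in_fset_set; last exact: dirsum_supp.
  by apply/idP/idP; rewrite inE.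
have := congr1 (amul (h e)) hx0.
rewrite (@dirsum_mapE _ F) => [|j]; last by rewrite inF.
rewrite amul_sumr -[0 in RHS](scale0r 0) amulZr scale0r => <-.
have [xi0|xi0] := eqVneq (x i) 0.
  rewrite xi0 -(alg_homM (hh i)) (e1 0).1 (alg_hom0 (hh i)) big_seq big1//.
  move=> j; rewrite inF => xj0; apply: h_orth.
  by apply: contra_neq xj0 => <-.
rewrite (big_fsetD1 i) ?inF//= [X in _ + X]big_seq [X in _ + X]big1 ?addr0//.
by move=> j; rewrite in_fsetD1 eq_sym => /andP[ij _]; exact: h_orth.
Qed.

End OrthogonalSum.

End AlgebraHomomorphisms.

Arguments quotalg_map {R A B J K} hJ hK f X.

Lemma isometry_inj (R : numFieldType) (A B : normedNuAlgType R) (f : A -> B) :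
  is_alg_hom f -> (forall x, `|f x| = `|x|) -> injective f.
Proof.
move=> hf fn; apply: alg_hom_inj hf _ => x fx.
by apply/normr0_eq0; rewrite -fn fx normr0.
Qed.

Lemma isometry_contains_copy (R : numFieldType) (A B : normedNuAlgType R)
    (f : B -> A) :
  is_alg_hom f -> (forall x, `|f x| = `|x|) -> contains_normed_copy A B.
Proof.
move=> hf fn; exists (range f), (alg_hom_range hf).
have [g [hg gbij gE]] := alg_hom_corange hf (isometry_inj hf fn).
by exists g; split=> // x; rewrite -[LHS]/`|val (g x)| gE.
Qed.

(** Homomorphisms are often easier to define in the direction opposite to the
wanted one; here restriction of functions goes from functions to sequences. *)
Lemma isometric_inverse (R : numFieldType) (A B : normedNuAlgType R)
    (f : A -> B) : is_alg_hom f -> (forall x, `|f x| = `|x|) ->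
  (forall y, exists x, f x = y) -> isometrically_isomorphic B A.
Proof.
move=> hf fn /choice[g gK]; have finj := isometry_inj hf fn.
exists g; split; first exact: alg_hom_can gK.
  by exists f => // x; apply: finj; rewrite gK.
by move=> y; rewrite -fn gK.
Qed.

(** * Summable sets *)

Section SummableSets.
Context {R : realType}.
Implicit Types A B : set nat.
Local Notation summable := (summable_set R).

Let weight_ge0 A n : 0 <= \1_A n * harmonic n :> R.
Proof. by rewrite mulr_ge0 ?harmonic_ge0// indicE. Qed.

Lemma summable_setS A B : A `<=` B -> summable B -> summable A.
Proof.
move=> AB; apply: series_le_cvg (weight_ge0 A) (weight_ge0 B) _ => n.
apply: ler_wpM2r; first exact: harmonic_ge0.
rewrite !indicE ler_nat; case: (boolP (n \in A)) => // /set_mem/AB nB.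
by rewrite mem_set.
Qed.

Lemma summable_setU A B : summable A -> summable B -> summable (A `|` B).
Proof.
move=> sA sB; apply: series_le_cvg (weight_ge0 _) _ _ (is_cvg_seriesD sA sB) => n.
  by apply: addr_ge0; exact: weight_ge0.
rewrite -[leRHS]/(\1_A n * harmonic n + \1_B n * harmonic n) -mulrDl.
apply: ler_wpM2r; first exact: harmonic_ge0.
rewrite !indicE in_setU -natrD ler_nat.
by case: (n \in A); case: (n \in B).
Qed.

Lemma summable_set_bounded A (M : R) :
  (forall N, \sum_(0 <= n < N) \1_A n * harmonic n <= M) -> summable A.
Proof.
move=> AM; apply: nondecreasing_is_cvgn.
  by apply: nondecreasing_series => n _ _; exact: weight_ge0.
by exists M => _ [N _ <-]; exact: AM.
Qed.

Lemma summable_set0 : summable set0.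
Proof.
apply: (@summable_set_bounded _ 0) => N; rewrite big1// => n _.
by rewrite indic0 mul0r.
Qed.

Lemma summable_set1 m : summable [set m].
Proof.
apply: (@summable_set_bounded _ (harmonic m)) => N.
have [mN|Nm] := ltnP m N.
  rewrite (bigD1_seq m) ?mem_index_iota ?iota_uniq//= big1 => [|n nm].
    by rewrite addr0 indicE mem_set// mul1r.
  by rewrite indicE memNset ?mul0r//; exact/eqP.
rewrite big_nat big1 ?harmonic_ge0// => n nN.
rewrite indicE memNset ?mul0r// => /= nm; move: nN.
by rewrite nm ltnNge Nm.
Qed.

Lemma not_summable_setT : ~ summable setT.
Proof.
move=> sT; apply: (@dvg_harmonic R).
apply: series_le_cvg harmonic_ge0 (weight_ge0 _) _ sT => n.
by rewrite indicT mul1r.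
Qed.

(** With the index shift, the elements of this range stand for the powers of 2,
whose reciprocals form a geometric series. *)
Lemma summable_powers : summable (range (fun j => (2 ^ j).-1)).
Proof.
pose p j := (2 ^ j).-1.
have pS j : (p j).+1 = (2 ^ j)%N by rewrite prednK// expn_gt0.
apply: (@summable_set_bounded _ 2) => N.
have geo K : \sum_(0 <= j < K) (2 ^- j : R) = 2 - 2 * 2 ^- K.
  elim: K => [|K IH]; first by rewrite big_geq// expr0 invr1; lra.
  by rewrite big_nat_recr//= IH exprS invfM; lra.
(* The weights up to [N] are dominated by the double sum over all pairs
   [n, j < N] with [p j = n]; since [j <= p j], every power below [N] is met. *)
apply: (@le_trans _ _ (\sum_(0 <= j < N) (2 ^- j : R))); last first.
  by rewrite geo gerBl mulr_ge0.
have le_p (j : nat) : (j <= p j)%N by rewrite -ltnS pS ltn_expl.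
apply: (@le_trans _ _
  (\sum_(0 <= n < N) \sum_(0 <= j < N) (if p j == n then harmonic n else 0))).
  apply: ler_sum_nat => n /= nN; rewrite indicE.
  case: (boolP (n \in _)) => [/set_mem[j _ jn]|_]; last first.
    by rewrite mul0r sumr_ge0// => j _; case: ifP => //; rewrite invr_ge0.
  rewrite mul1r (bigD1_seq j) ?iota_uniq//=; last first.
    by rewrite mem_index_iota/= (leq_ltn_trans (le_p j))// /p jn.
  rewrite ifT; last exact/eqP.
  rewrite lerDl sumr_ge0// => k _.
  by case: ifP => //; rewrite invr_ge0.
rewrite exchange_big/=; apply: ler_sum => j _.
have [jN|Nj] := ltnP (p j) N.
  rewrite (bigD1_seq (p j)) ?mem_index_iota ?iota_uniq//= big1 => [|n].
    by rewrite eqxx addr0 pS natrX.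
  by rewrite eq_sym => /negbTE ->.
rewrite big_nat big1 ?invr_ge0 ?exprn_ge0// => n /andP[_ nN].
by rewrite ifF//; apply/negP => /eqP pn; move: nN; rewrite -pn ltnNge Nj.
Qed.

End SummableSets.

(** * The ideal s00 *)

Section S00.
Context (R : realType).

Lemma s00_ideal : is_ideal (s00 R).
Proof.
split.
- by apply: summable_setS (@summable_set0 R) => n /=; rewrite eqxx.
- move=> a x y sx sy; apply: summable_setS (summable_setU sx sy) => n /=.
  apply: contra_neqP => /not_orP[/negP + /negP].
  rewrite !negbK => /eqP xn /eqP yn.
  by change (a * x n + y n = 0); rewrite xn yn mulr0 addr0.
- move=> x y; apply: summable_setS => n /=.
  by apply: contra_neq => yn; rewrite /= yn mulr0.
- move=> x y; apply: summable_setS => n /=.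
  by apply: contra_neq => xn; rewrite /= xn mul0r.
Qed.

Lemma indic_bfun (T : Type) (A : set T) : (\1_A : T -> R) \in bfun_pred.
Proof.
apply/bfun_predP; exists 1 => t; rewrite indicE.
by case: (t \in A); rewrite ?normr1 ?normr0.
Qed.

(** A unit would have to fix the indicator of every singleton, hence be the
constant sequence 1, whose support is not summable. *)
Lemma s00_nonunital (hs : is_ideal (s00 R)) : ~ unital (s00_alg hs).
Proof.
case=> u uP; apply: (@not_summable_setT R).
apply: summable_setS (subalg_valP u) => n _ /=.
have s1 : s00 R (Bfun (indic_bfun [set n])).
  apply: (summable_setS _ (@summable_set1 R n)) => m /=; rewrite indicE.
  by case: (boolP (m \in _)) => [/set_mem//|_]; rewrite eqxx.
pose d : s00_alg hs := Subalg (introT (subalg_predP _ _) s1).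
have := congr1 (fun z => bfun_val (val z) n) (uP d).1.
rewrite /= indicE mem_set//= mulr1 => ->; exact: oner_neq0.
Qed.

End S00.

(** * Push-forward along an injection *)

Section Pushforward.
Context {R : realType} (hs : is_ideal (s00 R)).
Context {T : Type} (a : T -> nat).

(** Extension by zero of [x] transported along [a]; the choice of the preimage
is immaterial when [a] is injective. *)
Definition push_fun (x : T -> R) (n : nat) : R :=
  if pselect (exists t, a t = n) is left an then x (sval (cid an)) else 0.

Lemma push_fun_out x n : (forall t, a t <> n) -> push_fun x n = 0.
Proof.
by move=> an; rewrite /push_fun; case: pselect => // -[t atn]; case: (an t).
Qed.

Hypothesis a_inj : injective a.

Lemma push_funE x t : push_fun x (a t) = x t.
Proof.
rewrite /push_fun; case: pselect => [an|[]]; last by exists t.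
by congr x; apply: a_inj; case: cid.
Qed.

(** Push-forwards are characterized by their values on and off the range of
[a]; every algebraic identity about [push_fun] is checked this way. *)
Lemma push_ext (x : T -> R) (y : nat -> R) :
  (forall t, y (a t) = x t) -> (forall n, (forall t, a t <> n) -> y n = 0) ->
  push_fun x = y.
Proof.
move=> ya y0; apply/funext => n; have [[t <-]|an] := pselect (exists t, a t = n).
  by rewrite push_funE ya.
have an' t : a t <> n by move=> atn; apply: an; exists t.
by rewrite push_fun_out ?y0.
Qed.

Lemma push_bounded (x : bfun R T) : push_fun x \in bfun_pred.
Proof.
have [M xM] := bfun_bounded x; apply/bfun_predP; exists (Num.max M 0) => n.
rewrite /push_fun; case: pselect => [an|_]; last by rewrite normr0 le_max lexx orbT.
by rewrite le_max xM.
Qed.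

Hypothesis a_summable : summable_set R (range a).

Lemma push_s00 (x : bfun R T) : s00 R (Bfun (@push_bounded x)).
Proof.
apply: summable_setS a_summable => n /=; apply: contra_neqP => an.
by apply: push_fun_out => t atn; apply: an; exists t.
Qed.

Definition push (x : bfun R T) : s00_alg hs :=
  Subalg (introT (subalg_predP (ideal_subalgebra hs) _) (@push_s00 x)).

Lemma push_val x n : bfun_val (val (push x)) n = push_fun x n.
Proof. by []. Qed.

Lemma push_hom : is_alg_hom push.
Proof.
split=> [c x y|x y]; apply: val_inj; apply/val_inj; apply: push_ext => [t|n an].
- rewrite -[LHS]/(c * push_fun x (a t) + push_fun y (a t)).
  by rewrite !push_funE.
- rewrite -[LHS]/(c * push_fun x n + push_fun y n).
  by rewrite !push_fun_out ?mulr0 ?addr0.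
- rewrite -[LHS]/(push_fun x (a t) * push_fun y (a t)).
  by rewrite !push_funE.
- rewrite -[LHS]/(push_fun x n * push_fun y n).
  by rewrite !push_fun_out ?mulr0.
Qed.

Lemma push_norm x : `|push x| = `|x|.
Proof.
apply/eqP; rewrite eq_le; apply/andP; split; apply: sup_range_le => //.
- move=> n; rewrite push_val.
  have [[t <-]|an] := pselect (exists t, a t = n).
    by rewrite push_funE; exact: (sup_range_ge t (bfun_bounded x)).
  rewrite push_fun_out ?normr0// => t atn.
  by apply: an; exists t.
- move=> t; rewrite -(push_funE x).
  exact: (sup_range_ge (a t) (bfun_bounded (val (push x)))).
Qed.

End Pushforward.

Section PushC00.
Context {R : realType} (hs : is_ideal (s00 R)).
Context {a : nat -> nat} (ai : injective a) (sa : summable_set R (range a)).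

(** An injection preserves and reflects finiteness of supports, so pushing
forward embeds [linfty] modulo [c00] into [s00] modulo [c00]. *)
Lemma push_c00 x : c00 R (val (push hs sa x)) <-> c00 R x.
Proof.
have -> : c00 R (val (push hs sa x)) =
    finite_set (a @` [set n | x n != 0]).
  congr finite_set; apply/seteqP; split=> [n /= xn|_ [n xn <-]]; last first.
    by rewrite /= push_funE.
  have [[m mn]|an] := pselect (exists m, a m = n).
    by exists m => //=; move: xn; rewrite -mn push_funE.
  move: xn; rewrite push_fun_out ?eqxx// => t atn.
  by apply: an; exists t.
split; last exact: finite_image.
by move=> /(finite_preimage (in2W ai)); apply: sub_finite_set => n; exists n.
Qed.

Lemma push_mul_c00 (b : nat -> nat) (sb : summable_set R (range b)) x y :
  finite_set (range a `&` range b) ->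
  c00 R (val (amul (push hs sa x) (push hs sb y))).
Proof.
apply: sub_finite_set => n /=; apply: contra_neqP => /not_andP[] an.
  rewrite (@push_fun_out _ _ a) ?mul0r// => t atn.
  by apply: an; exists t.
rewrite (@push_fun_out _ _ b) ?mulr0// => t atn.
by apply: an; exists t.
Qed.

End PushC00.

(** * Direct sums inside s00 and its quotient *)

Section Flatten.
Context {R : realType}.
Local Notation D := (dirsum (fun _ : nat => linfty R)).

Lemma flat_bounded (x : D) : (fun p => x p.1 p.2) \in @bfun_pred R (nat * nat).
Proof.
have [M xM] := dirsum_bounded x; apply/bfun_predP; exists M => p.
exact: le_trans (sup_range_ge p.2 (bfun_bounded (x p.1))) (xM p.1).
Qed.

Definition flat (x : D) : bfun R (nat * nat) := Bfun (@flat_bounded x).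

Lemma flat_hom : is_alg_hom flat.
Proof. by split=> *; apply: val_inj. Qed.

Lemma flatnorm x : `|flat x| = `|x|.
Proof.
apply/eqP; rewrite eq_le; apply/andP; split; apply: sup_range_le => //.
  move=> p; apply: le_trans (sup_range_ge p.1 (dirsum_bounded x)).
  exact: (sup_range_ge p.2 (bfun_bounded (x p.1))).
move=> k; apply: sup_range_le => // m.
exact: (sup_range_ge (k, m) (bfun_bounded (flat x))).
Qed.

End Flatten.

(** An injection of any countable type into the summable set of powers of 2
(up to the index shift). *)
Definition power_code (T : countType) (t : T) : nat := (2 ^ pickle t).-1.

Lemma power_code_inj (T : countType) : injective (@power_code T).
Proof.
move=> s t /(congr1 succn); rewrite !prednK ?expn_gt0// => /(expnI (ltnSn 1)).
exact: (pcan_inj pickleK).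
Qed.

Lemma summable_power_code (R : realType) (T : countType) (S : Type) (f : S -> T) :
  summable_set R (range (power_code (T:=T) \o f)).
Proof.
apply: summable_setS (@summable_powers R) => _ [s _ <-].
by exists (pickle (f s)).
Qed.

Lemma s00_contains_linfty_sum (R : realType) (hs : is_ideal (s00 R)) :
  contains_normed_copy (s00_alg hs) (dirsum (fun _ : nat => linfty R)).
Proof.
have ci := @power_code_inj (nat * nat)%type.
have sc := @summable_power_code R (nat * nat)%type _ id.
apply: (@isometry_contains_copy _ _ _ (push hs sc \o flat)).
  exact: alg_hom_comp flat_hom (push_hom _ _ _).
by move=> x; rewrite -flatnorm; exact: push_norm.
Qed.

(** The branch of the binary tree along [g], a node being coded from the finite
word that leads to it. Distinct branches share only finitely many nodes, so
the branches form an almost disjoint family of size continuum. *)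
Definition branch (g : nat -> bool) (m : nat) : nat := power_code (mkseq g m).

(** The word can be decoded, so a common node determines its level and forces
both branches to agree below it. *)
Lemma branch_eq g h m k : branch g m = branch h k ->
  m = k /\ forall i, (i < m)%N -> g i = h i.
Proof.
move=> /power_code_inj gh.
have mk : m = k by rewrite -(size_mkseq g m) gh size_mkseq.
split=> // i im; have := congr1 (fun s => nth false s i) gh.
by rewrite !nth_mkseq// -mk.
Qed.

Lemma branch_inj g : injective (branch g).
Proof. by move=> m k /branch_eq[]. Qed.

Lemma summable_branch (R : realType) g : summable_set R (range (branch g)).
Proof. exact: (@summable_power_code R (seq bool) nat (mkseq g)). Qed.

Lemma branch_almost_disjoint g h : g <> h ->
  finite_set (range (branch g) `&` range (branch h)).
Proof.
move=> gh; have [k ghk] : exists k, g k <> h k.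
  by apply/existsNP => ghE; apply: gh; exact/funext.
apply: (@sub_finite_set _ _ (branch g @` `I_k.+1)).
  move=> n [[m _ <-] [m' _ /esym/branch_eq[_ ghm]]]; exists m => //=.
  by rewrite ltnS leqNgt; apply/negP => /ghm.
exact/finite_image/finite_II.
Qed.

Lemma linfty_mod_c00_unital (R : realType) : unital (linfty_mod_c00 R).
Proof.
exists (quotalg_pi (c00_ideal R) (Bfun (indic_bfun R [set: nat]))) => X.
have [x ->] := quotalg_piW X.
rewrite /amul/= !quotalg_piM; split; congr quotalg_pi; apply/bfun_eqP => n.
  by rewrite /= indicT mul1r.
by rewrite /= indicT mulr1.
Qed.

(** Pushing forward along the branch of [g i] embeds the [i]-th summand; by
almost disjointness the products of elements coming from different summands
have finite support, so the embeddings are orthogonal modulo [c00]. *)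
Lemma s00_mod_c00_contains_quotient_sum (R : realType) (hs : is_ideal (s00 R))
    (I : Type) (g : I -> nat -> bool) : injective g ->
  contains_copy (s00_mod_c00 hs) (dirsum (fun _ : I => linfty_mod_c00 R)).
Proof.
move=> ginj; pose p i := push hs (@summable_branch R (g i)).
have p_hom i : is_alg_hom (p i) by apply: push_hom; exact: branch_inj.
have pJ i x : c00 R (val (p i x)) <-> c00 R x.
  exact: push_c00 (@branch_inj (g i)) _ x.
pose J := subalg_ideal (ideal_subalgebra hs) (c00_ideal R).
pose h (i : {classic I}) := quotalg_map (c00_ideal R) J (p i).
have hh i : is_alg_hom (h i).
  by apply: (quotalg_map_hom _ _ (p_hom i)) => x; exact: (pJ i x).2.
have h_orth (i j : {classic I}) x y : i != j -> amul (h i x) (h j y) = 0.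
  move=> ij; rewrite /h /quotalg_map {1}/amul/= quotalg_piM.
  apply/(quotalg_pi_eq0 J)/push_mul_c00.
  by apply: branch_almost_disjoint => /ginj gij; move: ij; rewrite gij eqxx.
apply: (@inj_hom_contains_copy _ _ _ (dirsum_map h)).
  exact: dirsum_map_hom.
apply: dirsum_map_inj => // i; first exact: linfty_mod_c00_unital.
apply: (@quotalg_map_inj _ _ _ _ _ _ J _ (p_hom i)) => x.
  exact: (pJ i x).2.
exact: (pJ i x).1.
Qed.

(** * Functions with compact support *)

(** Compactness does not depend on the ambient space. *)
Lemma compact_preimage_set_val (X : topologicalType) (Y C : set X) :
  compact C -> C `<=` Y -> compact (set_val @^-1` C : set (set_type Y)).
Proof.
move=> cC CY F PF FC; have [p [Cp clp]] := cC (set_val @ F) _ FC.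
exists (exist _ p (mem_set (CY p Cp))); split=> // A B FA [_ [[V oV <-] Vp] VB].
have FA' : (set_val @ F) (set_val @` A).
  by rewrite /fmap /=; apply: (@filterS _ F _ A _ _ FA) => x Ax; exists x.
have [_ [[x Ax <-] Vx]] := clp _ V FA' (open_nbhs_nbhs (conj oV Vp)).
by exists x; split=> //; exact: VB.
Qed.

(** In a directed family the members of a finite subcover are dominated by a
single one; this is near-covering compactness along the filter of the tails
of the family. *)
Lemma compact_directed_cover (X : topologicalType) (K : set X) (I : Type)
    (D : set I) (f : I -> set X) :
  compact K -> D !=set0 ->
  (forall i j, D i -> D j -> exists2 k, D k & f i `|` f j `<=` f k) ->
  (forall i, D i -> open (f i)) -> K `<=` \bigcup_(i in D) f i ->
  exists2 i, D i & K `<=` f i.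
Proof.
move=> /compact_near_coveringP cK D0 Ddir fop Kf.
pose F := filter_from D (fun i => [set k | D k /\ f i `<=` f k]).
have FF : Filter F.
  apply: filter_from_filter => // i j Di Dj.
  have [k Dk ijk] := Ddir i j Di Dj; exists k => // l [Dl kl].
  by split; split=> // x xi; apply/kl/ijk; [left|right].
have [i Di iK] : F [set i | K `<=` f i].
  apply: (cK _ F (fun i x => f i x) FF) => x /Kf[i Di xi].
  exists (f i, [set k | D k /\ f i `<=` f k]).
    split; last by exists i.
    by apply: open_nbhs_nbhs; split=> //; exact: fop.
  by move=> [y k] [yi [_ ik]]; exact: ik.
by exists i => //; apply: iK; split.
Qed.

Lemma continuous_nat (X : topologicalType) (f : nat -> X) : continuous f.
Proof.
move=> n U /nbhs_singleton Un; have : nbhs n (f @^-1` U); last by [].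
by rewrite nbhs_principalE; apply/principal_filterP.
Qed.

Section StoneCech.
Context {R : realType} {bN : topologicalType} {e : nat -> bN}.
Hypothesis hb : is_stone_cech R e.

Lemma stone_cech_extend_seq (x : linfty R) :
  exists2 g : bN -> R, continuous g & forall n, g (e n) = x n.
Proof.
apply: (stone_cech_extend hb (@continuous_nat _ (x : nat -> R))).
exact/asboolP/(valP x).
Qed.

Lemma stone_cech_near (p : bN) (V : set bN) : nbhs p V -> exists n, V (e n).
Proof.
rewrite nbhsE => -[U [oU Up] UV].
have [|q [Uq [n _ en]]] := @stone_cech_dense _ _ _ _ hb U _ oU.
  by exists p.
by exists n; apply: UV; rewrite en.
Qed.

Lemma closure_image_closed (g : bN -> R) (D : set R) (A : set nat) p :
  continuous g -> closed D -> (forall n, A n -> D (g (e n))) ->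
  closure (e @` A) p -> D (g p).
Proof.
move=> cg cD AD; have cgD : closed (g @^-1` D).
  by apply: preimage_closed cD => q _; exact: cg.
move=> Ap; suff : (g @^-1` D) p by [].
rewrite ((closure_id _).1 cgD); apply: closureS Ap => _ [n An <-]; exact: AD.
Qed.

(** The closure of a set of integers is cut out by the extension of its
indicator; in particular it is clopen and contains no further integers. Any
threshold between 0 and 1 would do in place of [1 / 2]. *)
Lemma closure_imageE (A : set nat) : exists2 g : bN -> R, continuous g &
  closure (e @` A) = [set p | 1 / 2 < g p] /\ forall n, g (e n) = \1_A n.
Proof.
have [g cg gE] := stone_cech_extend_seq (Bfun (indic_bfun R A)).
exists g => //; split=> //; apply/seteqP; split=> p /=.
  move=> /(closure_image_closed (D := [set 1]) cg) -> //; first by lra.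
  by move=> n An; rewrite gE /= indicE mem_set.
move=> gp V pV; have gV : nbhs p (V `&` g @^-1` [set r | 1 / 2 < r]).
  by apply: filterI => //; apply: cg; apply: open_nbhs_nbhs; split.
have [n [Vn /=]] := stone_cech_near gV; rewrite gE /= indicE => gn.
exists (e n); split=> //; exists n => //; move: gn.
by case: (boolP (n \in A)) => [/set_mem//|_] /=; lra.
Qed.

Lemma closure_image_open (A : set nat) : open (closure (e @` A)).
Proof.
have [g cg [-> _]] := closure_imageE A.
rewrite -[X in open X]/(g @^-1` [set r | 1 / 2 < r]).
by move/continuousP: cg; apply; exact: open_gt.
Qed.

Lemma closure_image_mem (A : set nat) n : closure (e @` A) (e n) -> A n.
Proof.
have [g cg [-> gE]] := closure_imageE A; rewrite /= gE indicE.
by case: (boolP (n \in A)) => [/set_mem//|_] /=; lra.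
Qed.

Local Notation Y := (Yset R e).

Lemma Yset_e n : Y (e n).
Proof.
by exists [set n]; [exact: summable_set1|apply: subset_closure; exists n].
Qed.

Definition Yset_of_nat n : set_type Y := exist _ (e n) (mem_set (Yset_e n)).

(** A bound on the integers holds on all of [Y], the integers being dense. *)
Lemma Yset_le (f : set_type Y -> R) (M : R) : continuous f ->
  (forall n, `|f (Yset_of_nat n)| <= M) -> forall p, `|f p| <= M.
Proof.
move=> cf fM p; rewrite leNgt; apply/negP => Mf.
have : nbhs p (f @^-1` [set r | M < `|r|]).
  apply: cf; apply: open_nbhs_nbhs; split=> //.
  apply: (@open_comp _ _ (fun r : R => `|r|) [set r | M < r]); last exact: open_gt.
  by move=> r _; exact: norm_continuous.
rewrite nbhsE => -[_ [[V oV <-] Vp] VM].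
have [n Vn] := stone_cech_near (open_nbhs_nbhs (conj oV Vp)).
by have := VM (Yset_of_nat n) Vn; rewrite /= ltNge fM.
Qed.

Context (hs : is_ideal (s00 R)).

Lemma restrict_bfun (f : bfun R (set_type Y)) : f \o Yset_of_nat \in bfun_pred.
Proof.
by have [M fM] := bfun_bounded f; apply/bfun_predP; exists M => n; exact: fM.
Qed.

(** The clopen sets whose union defines [Y] are directed, as a union of two
summable sets is summable; hence one of them contains the compact support of
[f], and the support of the restriction lies in a summable set. *)
Lemma restrict_s00 (f : C00 R Y) : s00 R (Bfun (@restrict_bfun (val f))).
Proof.
have [_ /compact_directed_cover cK] := subalg_valP f.
have [|A B sA sB|A _|p _|A sA fA] := cK _ (summable_set R)
  (fun A => set_val @^-1` closure (e @` A)).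
- by exists set0; exact: summable_set0.
- exists (A `|` B); first exact: summable_setU.
  by rewrite -preimage_setU -closureU image_setU.
- by exists (closure (e @` A)) => //; exact: closure_image_open.
- by have [A sA pA] := set_valP p; exists A.
apply: summable_setS sA => n fn; apply: closure_image_mem.
by apply: (fA (Yset_of_nat n)); apply: subset_closure.
Qed.

Definition restrict (f : C00 R Y) : s00_alg hs :=
  Subalg (introT (subalg_predP (ideal_subalgebra hs) _) (@restrict_s00 f)).

Lemma restrict_hom : is_alg_hom restrict.
Proof. by split=> *; apply: val_inj; apply: val_inj. Qed.

Lemma restrict_norm f : `|restrict f| = `|f|.
Proof.
apply/eqP; rewrite eq_le; apply/andP; split; apply: sup_range_le => //.
  move=> n.
  exact: (sup_range_ge (Yset_of_nat n) (bfun_bounded (val f))).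
have [cf _] := subalg_valP f.
apply: Yset_le => // n.
exact: (sup_range_ge n (bfun_bounded (val (restrict f)))).
Qed.

(** The extension of [x] to the compactification vanishes off the closure of
the support of [x], a compact set contained in [Y]. *)
Lemma restrict_surj x : exists f, restrict f = x.
Proof.
have [g cg gE] := stone_cech_extend_seq (val x).
have cf : continuous (g \o set_val : set_type Y -> R).
  move=> p; apply: (@continuous_comp _ bN _ set_val g); last exact: cg.
  exact: initial_continuous.
have fb : (g \o set_val : set_type Y -> R) \in bfun_pred.
  have [M xM] := bfun_bounded (val x); apply/bfun_predP; exists M.
  by apply: Yset_le => // n; rewrite /= gE.
pose A := [set n | bfun_val (val x) n != 0].
have sA : summable_set R A := subalg_valP x.
have fC : csupp_set (Bfun fb).
  split=> //; apply: subclosed_compact; first exact: closed_closure.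
    apply: (@compact_preimage_set_val _ _ (closure (e @` A))).
      apply: subclosed_compact (stone_cech_compact hb) _ => //.
      exact: closed_closure.
    by move=> p pA; exists A.
  have cA : closed (set_val @^-1` closure (e @` A) : set (set_type Y)).
    apply: preimage_closed; last exact: closed_closure.
    by move=> p _; exact: initial_continuous.
  rewrite [X in _ `<=` X]((closure_id _).1 cA); apply: closureS => p /= gp V pV.
  have [n [Vn /= gn]] : exists n, (V `&` g @^-1` [set r | r != 0]) (e n).
    apply: (@stone_cech_near (set_val p)); apply: filterI => //; apply: cg.
    by apply: open_nbhs_nbhs; split=> //; exact: open_neq.
  by exists (e n); split=> //; exists n => //=; rewrite /A /= -gE.
exists (Subalg (introT (subalg_predP (csupp_subalgebra R Y) _) fC)).
by apply: val_inj; apply/bfun_eqP => n; exact: gE.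
Qed.

Lemma s00_isometric_C00 : isometrically_isomorphic (s00_alg hs) (C00 R Y).
Proof. exact: isometric_inverse restrict_hom restrict_norm restrict_surj. Qed.

End StoneCech.

Theorem theorem4p1 (R : realType)
    (bN : topologicalType) (e : nat -> bN) (hb : is_stone_cech R e)
    (I : Type) (hI : ([set: I] #= [set: nat -> bool])%card) :
  exists hs : is_ideal (s00 R),
    [/\ ~ unital (s00_alg hs),
        isometrically_isomorphic (s00_alg hs) (C00 R (Yset R e)),
        contains_normed_copy (s00_alg hs) (dirsum (fun _ : nat => linfty R)) &
        contains_copy (s00_mod_c00 hs) (dirsum (fun _ : I => linfty_mod_c00 R))].
Proof.
pose hs := s00_ideal R; exists hs; split.
- exact: s00_nonunital.
- exact: s00_isometric_C00.
- exact: s00_contains_linfty_sum.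
- have /pcard_injP[g ginj] : ([set: I] #<= [set: nat -> bool])%card.
    by case/card_eqPle: hI.
  apply: (s00_mod_c00_contains_quotient_sum hs) => i j.
  by apply: ginj; rewrite inE.
Qed.
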